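(* The class $\mathcal{C}$ of all finite digraphs that contain a directed cycle can be decided by an adaptive left unbounded query algorithm over $\mathbb{B}$, but not by an adaptive left $k$-query algorithm over $\mathbb{B}$, for any $k$.
   Context: Digraphs are finite structures $(V,R)$, $V\ne\varnothing$, $R\subseteq V\times V$; a directed cycle is a sequence of distinct vertices $a_0,\dots,a_{\ell-1}$ ($\ell\ge1$) with $(a_i,a_{i+1})\in R$ for $i<\ell-1$ and $(a_{\ell-1},a_0)\in R$. $\mathsf{FIN}$ is the class of all digraphs. $\hom_{\mathbb{B}}(F,A)$ is $1$ if there is a homomorphism $F\to A$ and $0$ otherwise. For a set $\Sigma$, $\Sigma^{<\omega}$ is the set of finite strings over $\Sigma$; a subtree is a prefix-closed subset, a leaf an element with no proper extension. An adaptive left unbounded query algorithm over $\mathbb{B}$ is a function $G:\mathcal{T}\to\mathsf{FIN}\cup\{\mathsf{YES},\mathsf{NO}\}$ with $\mathcal{T}\subseteq\{0,1\}^{<\omega}$ a subtree and $G(\sigma)\in\{\mathsf{YES},\mathsf{NO}\}$ iff $\sigma$ is a leaf; its computation path on $A$ is the (possibly infinite) limit of $\sigma_0=\varepsilon$, $\sigma_{i+1}=\sigma_i$ if $G(\sigma_i)\in\{\mathsf{YES},\mathsf{NO}\}$, else $\sigma_{i+1}=\sigma_i\bullet\hom_{\mathbb{B}}(G(\sigma_i),A)$. Only total algorithms are considered: the path must be finite for every input; the algorithm decides $\{A:G(\text{path of }A)=\mathsf{YES}\}$. It is an adaptive left $k$-query algorithm if all computation paths have length at most $k$. *)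

(* Defs.v *)
From mathcomp Require Import all_boot.

Set Implicit Arguments.
Unset Strict Implicit.
Unset Printing Implicit Defensive.

Record digraph : Type := Digraph {
  vertex :> finType;
  edge : rel vertex;
  vertex_gt0 : 0 < #|vertex|
}.

Definition homB (F A : digraph) : bool :=
  [exists f : {ffun F -> A},
     [forall x, forall y, edge x y ==> edge (f x) (f y)]].

(* The sequence [c] lists the vertices of the cycle without repeating the first
   one; a single vertex with a loop is a cycle. *)
Definition has_directed_cycle (A : digraph) : Prop :=
  exists c : seq A, [/\ c != [::], uniq c & cycle (@edge A) c].

Definition subtree (Sigma : eqType) (T : seq Sigma -> Prop) : Prop :=
  forall s t : seq Sigma, prefix s t -> T t -> T s.

Definition leaf (Sigma : eqType) (T : seq Sigma -> Prop) (s : seq Sigma) : Prop :=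
  T s /\ forall t : seq Sigma, T t -> prefix s t -> t = s.

Inductive node : Type := Query of digraph | YES | NO.

Definition is_answer (v : node) : bool := if v is Query _ then false else true.

(* The function G is represented by a total function whose values outside [tree]
   are irrelevant: [total_algorithm] requires computations to stay inside [tree]. *)
Record algorithm : Type := Algorithm {
  tree : seq bool -> Prop;
  label : seq bool -> node;
  tree_subtree : subtree tree;
  label_leaf : forall s, tree s -> (is_answer (label s) <-> leaf tree s)
}.

Fixpoint state (G : algorithm) (A : digraph) (i : nat) : seq bool :=
  if i is j.+1 then
    let s := state G A j in
    if label G s is Query F then rcons s (homB F A) else s
  else [::].

(* [s] is the limit of the strings [state G A i], i.e. the computation path of
   [G] on [A] is finite and equal to [s]. *)
Definition computation_path (G : algorithm) (A : digraph) (s : seq bool) : Prop :=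
  exists n, forall i, n <= i -> state G A i = s.

Definition total_algorithm (G : algorithm) : Prop :=
  forall A : digraph,
    (forall i, tree G (state G A i)) /\ exists s, computation_path G A s.

Definition decides (G : algorithm) (C : digraph -> Prop) : Prop :=
  forall A : digraph,
    C A <-> exists s, computation_path G A s /\ label G s = YES.

Definition k_query (k : nat) (G : algorithm) : Prop :=
  forall A : digraph, exists s, computation_path G A s /\ size s <= k.

(* Main.v *)
Require Import Defs.
From mathcomp Require Import all_boot.

Set Implicit Arguments.
Unset Strict Implicit.
Unset Printing Implicit Defensive.

(** The algorithm alternately asks for homomorphisms from the directed cycles
    [C_1, C_2, ...] and from longer and longer directed paths: a digraph with a
    directed cycle of length [n] receives all paths and receives [C_n], while an
    acyclic digraph receives no cycle and no path on more vertices than it has.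

    For the lower bound, a [k]-query algorithm only ever asks about the finitely
    many digraphs labelling strings of length at most [k]; let [N] bound their
    sizes.  Such a digraph maps to the transitive tournament [T] on [N + 1]
    vertices iff it is acyclic, iff it maps to the disjoint union of [T] and
    [C_(N+1)].  Hence the algorithm cannot separate these two digraphs, only one
    of which is acyclic. *)

(** * Closed walks *)

(** Repetitions are allowed, so closed walks, unlike cycles, are preserved by homomorphisms. *)
Definition closed_walk (A : digraph) (l : nat) (f : nat -> A) : Prop :=
  [/\ 0 < l, f l = f 0 & forall i, i < l -> edge (f i) (f i.+1)].

Lemma homBP (F A : digraph) :
  reflect (exists f : F -> A, forall x y, edge x y -> edge (f x) (f y))
          (homB F A).
Proof.
apply: (iffP existsP) => [[f /forallP homf]|[f homf]].
  by exists f => x y; have /forallP/(_ y)/implyP := homf x.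
exists [ffun x => f x]; apply/forallP => x; apply/forallP => y.
by apply/implyP => /homf; rewrite !ffunE.
Qed.

(** Drop the last edge, shorten the remaining path to one without repetition between the same
    endpoints, and close it again with that edge. *)
Lemma closed_walk_cycle (A : digraph) (l : nat) (f : nat -> A) :
  closed_walk l f -> has_directed_cycle A.
Proof.
case: l => [|l] [] // _ fl fe.
have pth : path (@edge A) (f 0) [seq f i | i <- iota 1 l].
  apply/(pathP (f 0)) => i; rewrite size_map size_iota => lt_il.
  rewrite -map_cons -/(iota 0 l.+1) !(nth_map 0) ?size_iota //
    ?ltnS ?(ltnW lt_il) //.
  by rewrite !nth_iota ?ltnS ?(ltnW lt_il) //; apply: fe; apply: ltnW.
have lastE : last (f 0) [seq f i | i <- iota 1 l] = f l.
  by rewrite last_map (last_nth 0) size_iota -/(iota 0 l.+1) nth_iota.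
case/shortenP: pth lastE => p' pth' uniq' _ lastE.
by exists (f 0 :: p'); split; rewrite //= rcons_path pth' lastE -fl fe.
Qed.

Lemma cycle_closed_walk (A : digraph) :
  has_directed_cycle A ->
  exists l f, l <= #|A| /\ @closed_walk A l f.
Proof.
case=> -[|x p] [] // _ Up /= /(pathP x) cp.
(* Repeating [x] at the end turns the closing edge into an ordinary step. *)
exists (size p).+1, (nth x (x :: rcons p x)); split.
  by have := max_card [in x :: p]; rewrite (card_uniqP Up).
split=> //= [|i il]; first by rewrite nth_rcons ltnn eqxx.
by apply: cp; rewrite size_rcons.
Qed.

Lemma homB_cycle (F A : digraph) :
  homB F A -> has_directed_cycle F -> has_directed_cycle A.
Proof.
move=> /homBP[h homh] /cycle_closed_walk[l [f [_ [l0 fl fe]]]].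
apply: (@closed_walk_cycle _ l (h \o f)).
by split=> //= [|i /fe/homh //]; rewrite fl.
Qed.

(** Pigeonhole: two of the [#|A|.+1] vertices visited coincide, and the walk between them is
    closed. *)
Lemma long_walk_cycle (A : digraph) (f : nat -> A) :
  (forall i, i < #|A| -> edge (f i) (f i.+1)) -> has_directed_cycle A.
Proof.
move=> fe; pose g (i : 'I_#|A|.+1) := f i.
have /injectivePn[i [j neq_ij gij]] : ~~ injectiveb g.
  apply/negP => /injectiveP/leq_card; by rewrite card_ord ltnn.
wlog lt_ij : i j neq_ij gij / i < j.
  move=> W; case: (ltngtP i j) => [|/(W j i)|/val_inj eq_ij]; first exact: W.
    by apply; rewrite // eq_sym.
  by rewrite eq_ij eqxx in neq_ij.
apply: (@closed_walk_cycle _ (j - i) (fun k => f (i + k))); split.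
- by rewrite subn_gt0.
- by rewrite subnKC 1?ltnW // addn0 -[f j]/(g j) -gij.
move=> k; rewrite ltn_subRL => lt_k; rewrite addnS; apply: fe.
by apply: leq_trans lt_k _; rewrite -ltnS.
Qed.

(** * The unbounded algorithm *)

Lemma card_ordS_gt0 (n : nat) : 0 < #|'I_n.+1|.
Proof. by rewrite card_ord. Qed.

(* Indices are shifted: [dipath n] and [dicycle n] have [n.+1] vertices. *)
Definition dipath (n : nat) : digraph :=
  @Digraph 'I_n.+1 [rel i j : 'I_n.+1 | j == i.+1 :> nat] (card_ordS_gt0 n).

Definition dicycle (n : nat) : digraph :=
  @Digraph 'I_n.+1 [rel i j : 'I_n.+1 | j == i.+1 %% n.+1 :> nat]
    (card_ordS_gt0 n).

Lemma dicycle_cycle (n : nat) : has_directed_cycle (dicycle n).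
Proof.
apply: (@closed_walk_cycle (dicycle n) n.+1 (fun i => inord (i %% n.+1))).
split=> // [|i _] /=; first by rewrite modnn mod0n.
by rewrite !inordK ?ltn_mod // -[(i %% _).+1]addn1 modnDml addn1.
Qed.

Lemma dipath_hom (A : digraph) (n : nat) :
  has_directed_cycle A -> homB (dipath n) A.
Proof.
case/cycle_closed_walk=> l [f [_ [l0 fl fe]]].
(* The path winds around the closed walk; the wrap-around step uses [f l = f 0]. *)
apply/homBP; exists (fun i : 'I_n.+1 => f (i %% l)) => i j /= /eqP->.
have := fe (i %% l); rewrite ltn_mod l0 => /(_ isT).
suff -> : f (i %% l).+1 = f (i.+1 %% l) by [].
have -> : i.+1 %% l = (i %% l).+1 %% l.
  by rewrite -[(i %% l).+1]addn1 modnDml addn1.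
have : (i %% l).+1 <= l by rewrite ltn_mod.
by rewrite leq_eqVlt => /predU1P[->|/modn_small-> //]; rewrite modnn.
Qed.

Lemma dipath_cycle (A : digraph) (n : nat) :
  #|A| <= n -> homB (dipath n) A -> has_directed_cycle A.
Proof.
move=> le_An /homBP[h homh]; apply: (@long_walk_cycle _ (fun i => h (inord i))).
move=> i lt_i; have lt_in := leq_trans lt_i le_An; apply: homh => /=.
by rewrite !inordK // ltnS ltnW.
Qed.

Lemma dicycle_hom (A : digraph) :
  has_directed_cycle A -> exists n, homB (dicycle n) A.
Proof.
case/cycle_closed_walk=> -[|n] [f [_ []]] // _ fl fe; exists n.
apply/homBP; exists (fun i : 'I_n.+1 => f i) => i j /= /eqP->.
have := fe i (ltn_ord i); have := ltn_ord i.
by rewrite leq_eqVlt => /predU1P[->|/modn_small-> //]; rewrite modnn fl.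
Qed.

(* Any labelling of all strings yields an algorithm on the tree it cuts out. *)
Definition label_tree (lab : seq bool -> node) (s : seq bool) : Prop :=
  forall t, prefix t s -> t != s -> ~~ is_answer (lab t).

Lemma label_tree_subtree (lab : seq bool -> node) : subtree (label_tree lab).
Proof.
move=> s t pst Tt u pus neq_us; apply: Tt; first exact: prefix_trans pus pst.
apply: contra neq_us => /eqP eq_ut; rewrite eq_ut in pus *.
case/prefixP: pus pst => v ->; case/prefixP => w /eqP.
by rewrite -catA -{1}[t]cats0 eqseq_cat // eqxx; case: v => //=; rewrite cats0.
Qed.

Lemma prefix_rconsE (T : eqType) (t s : seq T) (x : T) :
  prefix t (rcons s x) = (t == rcons s x) || prefix t s.
Proof.
elim: s t => [|y s IHs] [|z t] //=.
  by case: t => [|w t]; rewrite ?andbF ?eqseq_cons ?andbT ?andbF orbF.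
by rewrite IHs eqseq_cons -andb_orr.
Qed.

Lemma label_tree_rcons (lab : seq bool -> node) (s : seq bool) (b : bool) :
  label_tree lab s -> ~~ is_answer (lab s) -> label_tree lab (rcons s b).
Proof.
move=> Ts nas t; rewrite prefix_rconsE => /predU1P[->|]; first by rewrite eqxx.
by move=> pts _; have [->|] := eqVneq t s; last exact: Ts.
Qed.

Lemma label_tree_leaf (lab : seq bool -> node) (s : seq bool) :
  label_tree lab s -> (is_answer (lab s) <-> leaf (label_tree lab) s).
Proof.
move=> Ts; split=> [ans_s|[_ leaf_s]].
  split=> // t Tt pst; apply/eqP; apply: contraLR ans_s => neq_ts.
  by apply: Tt; rewrite // eq_sym.
apply: contraT => nas; have Ts1 := label_tree_rcons (b := true) Ts nas.
by move: (leaf_s _ Ts1 (prefix_rcons s true)) => /(congr1 size)/eqP; rewrite size_rcons eqn_leq ltnn.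
Qed.

Definition label_algorithm (lab : seq bool -> node) : algorithm :=
  Algorithm (@label_tree_subtree lab) (@label_tree_leaf lab).

Lemma label_algorithm_tree (lab : seq bool -> node) (A : digraph) (i : nat) :
  label_tree lab (state (label_algorithm lab) A i).
Proof.
elim: i => [|i IHi] /=; first by move=> t; rewrite prefixs0 => /eqP->.
case E: (lab _) => [F||] //; apply: label_tree_rcons => //; by rewrite E.
Qed.

Lemma computation_path_answer (G : algorithm) (A : digraph) (n : nat) :
  is_answer (label G (state G A n)) -> computation_path G A (state G A n).
Proof.
move=> ans; exists n => i /subnKC <-; elim: (i - n) => [|j IHj].
  by rewrite addn0.
by rewrite addnS /= IHj; case: (label _ _) ans.
Qed.

Lemma computation_path_uniq (G : algorithm) (A : digraph) (s t : seq bool) :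
  computation_path G A s -> computation_path G A t -> s = t.
Proof.
by move=> [m sm] [n tn]; rewrite -(sm (m + n)) ?leq_addr // tn ?leq_addl.
Qed.

(** Even indices run through all cycles. The paths skip some sizes, which is harmless: only their
    unbounded length matters. *)
Definition cycle_query (i : nat) : digraph :=
  if odd i then dipath i else dicycle i./2.

(* The computation goes on as long as the [i]-th answer is [odd i], that is, as
   long as all cycles are refused and all paths accepted. *)
Definition cycle_label (s : seq bool) : node :=
  if s == mkseq odd (size s) then Query (cycle_query (size s))
  else if last true s then YES else NO.

Definition cycle_algorithm : algorithm := label_algorithm cycle_label.

Lemma cycle_query_deviates (A : digraph) :
  exists i, homB (cycle_query i) A != odd i.
Proof.
(* This path has an odd index, so it is one of the queries, and it has more vertices than [A]. *)
have [acyc|] := boolP (homB (dipath #|A|.*2.+1) A).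
  have [|n hn] := @dicycle_hom A.
    by apply: dipath_cycle acyc; rewrite -addnn -addnS leq_addr.
  by exists n.*2; rewrite /cycle_query odd_double doubleK hn.
by move=> hn; exists #|A|.*2.+1; rewrite /cycle_query /= odd_double /= (negPf hn).
Qed.

(** The first deviating answer, at index [m], ends the computation: for even [m] a cycle was
    accepted, for odd [m] a path was refused. *)
Lemma cycle_algorithm_path (A : digraph) :
  exists s b, [/\ computation_path cycle_algorithm A s,
    label cycle_algorithm s = (if b then YES else NO)
    & b <-> has_directed_cycle A].
Proof.
have [m dev_m min_m] := ex_minnP (cycle_query_deviates A).
have run i : i <= m -> state cycle_algorithm A i = mkseq odd i.
  elim: i => // i IHi lt_im /=; rewrite IHi 1?ltnW // /cycle_label size_mkseq.
  rewrite eqxx mkseqS; have [->//|/min_m] := eqVneq (homB (cycle_query i) A) (odd i).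
  by rewrite leqNgt lt_im.
have stop : state cycle_algorithm A m.+1 = rcons (mkseq odd m) (~~ odd m).
  rewrite /= run // /cycle_label size_mkseq eqxx; congr rcons.
  by case: (homB _ _) (odd m) dev_m => [] [].
have lab_m :
    label cycle_algorithm (state cycle_algorithm A m.+1) =
      if ~~ odd m then YES else NO.
  rewrite stop /= /cycle_label size_rcons size_mkseq mkseqS last_rcons.
  by rewrite eqseq_rcons eqxx /=; case: (odd m).
exists (state cycle_algorithm A m.+1), (~~ odd m); split=> //.
  by apply: computation_path_answer; rewrite lab_m; case: (~~ _).
move: dev_m; rewrite /cycle_query; case: ifP => odd_m /=.
  by rewrite eqb_id => no_path; split=> //
    /(@dipath_hom _ m); rewrite (negPf no_path).
by rewrite eqbF_neg negbK => /homB_cycle/(_ (dicycle_cycle _)).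
Qed.

Lemma cycle_algorithm_total : total_algorithm cycle_algorithm.
Proof.
move=> A; split=> [i|]; first exact: label_algorithm_tree.
by have [s [b [path_s _ _]]] := cycle_algorithm_path A; exists s.
Qed.

Lemma cycle_algorithm_decides : decides cycle_algorithm has_directed_cycle.
Proof.
move=> A; have [s [b [path_s lab_s cycA]]] := cycle_algorithm_path A.
split=> [/cycA b1|[t [path_t lab_t]]]; first by exists s; rewrite lab_s b1.
apply/cycA; move: lab_t; rewrite -(computation_path_uniq path_s path_t) lab_s.
by case: b {cycA lab_s}.
Qed.

(** * The lower bound *)

Definition tournament (n : nat) : digraph :=
  @Digraph 'I_n.+1 [rel i j : 'I_n.+1 | i < j] (card_ordS_gt0 n).

Definition sum_edge (A B : digraph) : rel (A + B) := fun u v =>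
  match u, v with
  | inl x, inl y => edge x y
  | inr x, inr y => edge x y
  | _, _ => false
  end.

Lemma sum_gt0 (A B : digraph) : 0 < #|{: A + B}|.
Proof. by rewrite card_sum addn_gt0 vertex_gt0. Qed.

Definition digraph_sum (A B : digraph) : digraph :=
  Digraph (@sum_edge A B) (sum_gt0 A B).

Lemma homB_suml (F A B : digraph) : homB F A -> homB F (digraph_sum A B).
Proof.
by move=> /homBP[h homh]; apply/homBP; exists (fun x => inl (h x)).
Qed.

Lemma homB_sumr (F A B : digraph) : homB F B -> homB F (digraph_sum A B).
Proof.
by move=> /homBP[h homh]; apply/homBP; exists (fun x => inr (h x)).
Qed.

Lemma homB_refl (A : digraph) : homB A A.
Proof. by apply/homBP; exists id. Qed.

(** No edge joins the summands, so the walk stays in the one containing [f 0]. *)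
Lemma closed_walk_sum (A B : digraph) (l : nat) (f : nat -> digraph_sum A B) :
  closed_walk l f ->
  (exists g, @closed_walk A l g) \/ (exists g, @closed_walk B l g).
Proof.
case=> l0 fl fe; case f0: (f 0) => [a|b].
  (* The default [a] is never taken for [i <= l], as [fg] shows. *)
  pose g i := if f i is inl x then x else a.
  have fg i : i <= l -> f i = inl (g i).
    elim: i => [|i IHi] lt_il; first by rewrite /g f0.
    by have := fe i lt_il; rewrite IHi 1?ltnW // /g /= /sum_edge; case: (f i.+1).
  left; exists g; split=> // [|i lt_il]; first by rewrite /g fl.
  by have := fe i lt_il; rewrite !fg // ltnW.
pose g i := if f i is inr x then x else b.
have fg i : i <= l -> f i = inr (g i).
  elim: i => [|i IHi] lt_il; first by rewrite /g f0.
  by have := fe i lt_il; rewrite IHi 1?ltnW // /g /= /sum_edge; case: (f i.+1).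
right; exists g; split=> // [|i lt_il]; first by rewrite /g fl.
by have := fe i lt_il; rewrite !fg // ltnW.
Qed.

Lemma closed_walk_tournament (n l : nat) (f : nat -> tournament n) :
  ~ closed_walk l f.
Proof.
case=> l0 fl fe.
have incr i : i <= l -> f 0 + i <= f i.
  elim: i => [|i IHi] lt_il; first by rewrite addn0.
  by rewrite addnS; apply: leq_ltn_trans (IHi (ltnW lt_il)) (fe i lt_il).
by have := incr l (leqnn l); rewrite fl -{2}[nat_of_ord _]addn0 leq_add2l leqNgt l0.
Qed.

(** After [i] steps the position has advanced by [i] modulo [n.+1]; returning to the start forces
    divisibility. *)
Lemma closed_walk_dicycle (n l : nat) (f : nat -> dicycle n) :
  closed_walk l f -> n.+1 %| l.
Proof.
case=> l0 fl fe.
have walk i : i <= l -> f i = f 0 + i %[mod n.+1].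
  elim: i => [|i IHi] lt_il; first by rewrite addn0.
  have /= /eqP-> := fe i lt_il.
  by rewrite modn_mod -addn1 -modnDml IHi 1?ltnW // modnDml addn1 addnS.
have /eqP := walk l (leqnn l).
by rewrite fl -{1}[nat_of_ord _]addn0 eqn_modDl mod0n eq_sym.
Qed.

Lemma connect_edge_cycle (A : digraph) (x y : A) :
  edge x y -> connect (@edge A) y x -> has_directed_cycle A.
Proof.
move=> exy /connectP[p pth]; case/shortenP: pth => p' pth' uniq' _ lastE.
by exists (y :: p'); split; rewrite //= rcons_path pth' -lastE.
Qed.

(* An acyclic digraph is ranked by the number of ancestors of its vertices. *)
Lemma acyclic_hom_tournament (F : digraph) (n : nat) :
  #|F| <= n -> ~ has_directed_cycle F -> homB F (tournament n).
Proof.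
move=> le_Fn acyc; pose anc x := [set y | connect (@edge F) y x].
have anc_lt x : #|anc x| < n.+1 by rewrite ltnS (leq_trans (max_card _)).
apply/homBP; exists (fun x => Ordinal (anc_lt x)) => x y exy /=.
apply: proper_card; apply/properP; split.
  apply/subsetP => z; rewrite !inE => zx.
  exact: connect_trans zx (connect1 exy).
exists y; first by rewrite inE connect0.
by rewrite inE; apply/negP => /(connect_edge_cycle exy).
Qed.

(** A cycle of [F] has length at most [n]: its image can neither lie in the acyclic tournament nor
    close up in a cycle on [n.+1] vertices. *)
Lemma homB_tournament_sum (F : digraph) (n : nat) : #|F| <= n ->
  homB F (tournament n) = homB F (digraph_sum (tournament n) (dicycle n)).
Proof.
move=> le_Fn; apply/idP/idP => [/homB_suml //|/homBP[h homh]].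
apply: acyclic_hom_tournament => // /cycle_closed_walk[l [f [le_lF [l0 fl fe]]]].
have /closed_walk_sum[[g /closed_walk_tournament //]|[g /closed_walk_dicycle]] :
    closed_walk l (fun i => h (f i) : digraph_sum (tournament n) (dicycle n)).
  by split=> // [|i /fe/homh //]; rewrite fl.
by move/(dvdn_leq l0); rewrite leqNgt ltnS (leq_trans le_lF).
Qed.

(** Induction on [k], splitting off the first bit: each of its two values leaves a labelling of the
    remaining string. *)
Lemma query_size_bound (lab : seq bool -> node) (k : nat) :
  exists N, forall s F, size s <= k -> lab s = Query F -> #|F| <= N.
Proof.
elim: k lab => [|k IHk] lab.
  case E: (lab [::]) => [F||]; [exists #|F| | exists 0 | exists 0] => s F' /=;
    by rewrite leqn0 => /nilP->; rewrite E // => -[<-].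
have [N0 bound0] := IHk (fun s => lab (false :: s)).
have [N1 bound1] := IHk (fun s => lab (true :: s)).
have [N bound] : exists N, forall F, lab [::] = Query F -> #|F| <= N.
  by case: (lab [::]) => [F||]; [exists #|F| => F' [<-] | exists 0 | exists 0].
exists (maxn N (maxn N0 N1)) => -[|[] s] F /= le_sk labE; rewrite !leq_max.
- by rewrite (bound F).
- by rewrite (bound1 s F) ?orbT.
- by rewrite (bound0 s F) ?orbT.
Qed.

Lemma size_state_le (G : algorithm) (A : digraph) (i j : nat) :
  i <= j -> size (state G A i) <= size (state G A j).
Proof.
move=> /subnKC <-; elim: (j - i) => [|d IHd]; first by rewrite addn0.
by rewrite addnS /=; case: (label _ _) => // F; rewrite size_rcons leqW.
Qed.

(** [k_query] bounds only the limit string, but the strings grow monotonically towards it. *)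
Lemma k_query_size_state (k : nat) (G : algorithm) (A : digraph) (i : nat) :
  k_query k G -> size (state G A i) <= k.
Proof.
move=> /(_ A)[s [[n path_s] le_sk]]; apply: leq_trans le_sk.
by rewrite -(path_s (i + n)) ?leq_addl // size_state_le ?leq_addr.
Qed.

(** As long as the strings agree, the same query is asked on both digraphs, and [n] bounds its size,
    so the answers agree too. *)
Lemma k_query_indistinguishable (k : nat) (G : algorithm) : k_query k G ->
  exists n, forall i,
    state G (tournament n) i =
    state G (digraph_sum (tournament n) (dicycle n)) i.
Proof.
move=> kG; have [n bound] := query_size_bound (label G) k.
exists n; elim=> //= i <-; case E: (label _ _) => [F||] //.
by rewrite homB_tournament_sum // (bound _ _ _ E) // k_query_size_state.
Qed.

Theorem theorem21 :
  (exists G : algorithm, total_algorithm G /\ decides G has_directed_cycle) /\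
  (forall k : nat,
     ~ exists G : algorithm,
         [/\ total_algorithm G, k_query k G & decides G has_directed_cycle]).
Proof.
split.
  by exists cycle_algorithm; split;
    [exact: cycle_algorithm_total | exact: cycle_algorithm_decides].
move=> k [G [_ kG decG]]; have [n same] := k_query_indistinguishable kG.
have /decG[s [[m path_s] lab_s]] :
    has_directed_cycle (digraph_sum (tournament n) (dicycle n)).
  exact: homB_cycle (homB_sumr _ (homB_refl _)) (dicycle_cycle n).
(* The accepting path on the sum is also the path on the tournament, which would then contain a
   cycle. *)
have /cycle_closed_walk[l [f [_ /closed_walk_tournament //]]] :
  has_directed_cycle (tournament n).
apply/decG; exists s; split=> //.
by exists m => i /path_s <-.
Qed.
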